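(* Let $p(x,y)=\sum c_{k,l}x^k y^l$ be a polynomial in two variables with real coefficients and let $C=\{(x,y)\in\mathbf{R}^2 : p(x,y)=0\}$, with the usual topology inherited from $\mathbf{R}^2$. Suppose that (1) $p$ is not divisible by $x$ or $y$ (that is, neither $x$ nor $y$ divides $p$), and (2) for every outer edge $E$ of the Newton polygon of $p$, the edge polynomial $e_E$ has no real zeroes. Then $C$ is compact.
   Context: For $p(x,y)=\sum c_{k,l}x^k y^l\in\mathbf{R}[x,y]$ (finite sum over integers $k,l\ge 0$), set $N=\{(k,l)\in\mathbf{Z}^2 : c_{k,l}\neq 0\}$. The Newton polygon of $p$ is the convex hull of $N$ in $\mathbf{R}^2$. If the Newton polygon is a nondegenerate line segment, that segment itself counts as an edge; if it is a single point, there are no edges. Each edge $E$ is given an orientation, with initial endpoint $(k'_E,l'_E)$ and final endpoint $(k''_E,l''_E)$ (these are distinct points of $N$). Define $$d_E=\gcd(k''_E-k'_E,\ l''_E-l'_E),\qquad p_E=\frac{k''_E-k'_E}{d_E},\qquad q_E=\frac{l''_E-l'_E}{d_E},$$ and the edge polynomial $e_E\in\mathbf{R}[t]$ by $$e_E(t)=\sum_{i=0}^{d_E} c_{k'_E+ip_E,\ l'_E+iq_E}\,t^i,$$ where $c_{k,l}=0$ for $(k,l)\notin N$. (Either orientation of $E$ may be chosen.) An edge $E$ is called outer if there are real numbers $a,b$, at least one of which is positive, such that the linear function $(k,l)\mapsto ak+bl$ on the Newton polygon attains its maximum at every point of $E$. *)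

(* Defs.v *)
From HB Require Import structures.
From mathcomp Require Import all_boot all_order all_algebra.
From mathcomp Require Import all_classical all_reals all_analysis.

Set Implicit Arguments.
Unset Strict Implicit.
Unset Printing Implicit Defensive.

Import Order.TTheory GRing.Theory Num.Theory.
Import numFieldNormedType.Exports.

Local Open Scope classical_set_scope.
Local Open Scope ring_scope.

(* A bivariate real polynomial is an element of {poly {poly R}}, with the
   conventions of polyXY: the outer variable 'X is x, the inner variable 'Y is
   y, p.[x, y] is the value at (x, y), and p`_k`_l is the coefficient of
   x^k y^l. *)

Notation plane R := (R^o * R^o)%type.

(* Integer exponents, since the definition of an edge polynomial uses
   differences of exponents; the coefficient is 0 at a negative exponent. *)
Definition coefXY (R : realType) (p : {poly {poly R}}) (k l : int) : R :=
  match k, l with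
  | Posz m, Posz n => p`_m`_n
  | _, _ => 0
  end.

Definition newton_support (R : realType) (p : {poly {poly R}}) :
    set (int * int) :=
  [set u | coefXY p u.1 u.2 != 0].

Definition lattice_point (R : realType) (u : int * int) : plane R :=
  (u.1%:~R, u.2%:~R).

Definition convex_hull (R : realType) (A : set (plane R)) : set (plane R) :=
  smallest (@convex_set R (plane R)) A.

Definition newton_polygon (R : realType) (p : {poly {poly R}}) :
    set (plane R) :=
  convex_hull (lattice_point R @` newton_support p).

Definition segment (R : realType) (u v : plane R) : set (plane R) :=
  [set t%:num *: u + (1 - t%:num) *: v | t in [set: {i01 R}]].

Definition argmax (R : realType) (a b : R) (P : set (plane R)) :
    set (plane R) :=
  [set z | P z /\ forall w, P w -> a * w.1 + b * w.2 <= a * z.1 + b * z.2].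

(* An edge is a one-dimensional face.  The case a = b = 0 is deliberately
   allowed: it makes P a face of itself, and this is an edge exactly when P is
   a nondegenerate segment. *)
Definition is_edge (R : realType) (P E : set (plane R)) : Prop :=
  (exists a b : R, E = argmax a b P) /\
  (exists u v : plane R, u != v /\ E = segment u v).

Definition is_outer_edge (R : realType) (P E : set (plane R)) : Prop :=
  is_edge P E /\
  exists a b : R, (0 < a \/ 0 < b) /\ E `<=` argmax a b P.

(* [o E] is the pair (initial endpoint, final endpoint) of the edge E. *)
Definition is_orientation (R : realType) (p : {poly {poly R}})
    (o : set (plane R) -> (int * int) * (int * int)) : Prop :=
  forall E, is_edge (newton_polygon p) E ->
    E = segment (lattice_point R (o E).1) (lattice_point R (o E).2).

Definition edge_poly (R : realType) (p : {poly {poly R}})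
    (u v : int * int) : {poly R} :=
  let d := gcdz (v.1 - u.1) (v.2 - u.2) in
  let pE := ((v.1 - u.1) %/ d)%Z in
  let qE := ((v.2 - u.2) %/ d)%Z in
  \poly_(i < `|d|%N.+1) coefXY p (u.1 + i%:Z * pE) (u.2 + i%:Z * qE).

(* Main.v *)
Require Import Defs.
From mathcomp Require Import all_boot all_order all_algebra.
From mathcomp Require Import all_classical all_reals all_analysis.
From mathcomp Require Import ring lra.

Set Implicit Arguments.
Unset Strict Implicit.
Unset Printing Implicit Defensive.

Import Order.TTheory GRing.Theory Num.Theory.
Import numFieldNormedType.Exports.
Local Open Scope classical_set_scope.
Local Open Scope ring_scope.

(** The zero set C is closed, so only an escape to infinity can prevent it from
    being compact.  Compactness is tested on an ultrafilter F containing C; the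
    point of ultrafilters is that every real function of z is, along F, either
    bounded below or divergent to -oo, so that no subsequence is ever extracted.

    If F stays in a box, it converges in C.  Otherwise |x| or |y| tends to +oo.
    As x and y do not divide p, the polynomials p(0, y) and p(x, 0) have bounded
    root sets, hence x and y are nonzero along F and the size of a monomial
    x^k y^l is the exponential of its weight k ln|x| + l ln|y|.  Let w0 be an
    exponent of maximal weight along F.  If the weights of all the other
    monomials fall infinitely far below, then p(z) is equivalent to a nonzero
    multiple of the monomial w0 and cannot vanish.  Otherwise another exponent
    w1 stays at bounded distance: the vector (ln|x|, ln|y|), which is unbounded,
    has a bounded component along w1 - w0, and thus escapes in a direction (a, b)
    orthogonal to w1 - w0.  One of its coordinates tends to +oo, so a or b is
    positive.  Comparing weights shows that w0 and w1 maximize a k + b l, so that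
    the face E of the Newton polygon cut out by (a, b) is an outer edge, and that
    all monomials off E become negligible (escape_edge).

    The monomials on E add up to a monomial times the edge polynomial at
    t = x^pE y^qE (edge_poly_sum).  Since w1 - w0 is a nonzero multiple of
    (pE, qE), t remains bounded, and on a bounded interval a polynomial without
    real zeros is bounded away from 0.  This contradicts p(z) = 0
    (rootless_edges_forbid_escape). *)

(** * The monomials of a bivariate polynomial *)

Definition monomXY (R : realType) (z : R * R) (w : int * int) : R :=
  z.1 ^ w.1 * z.2 ^ w.2.

Definition supp_seq (R : realType) (p : {poly {poly R}}) : seq (int * int) :=
  [seq w <- [seq (Posz k, Posz l) | k <- iota 0 (size p), l <- iota 0 (size p`_k)]
  | coefXY p w.1 w.2 != 0].

Section Poly.
Context {R : realType}.
Implicit Types (p : {poly {poly R}}) (z : R * R) (w : int * int).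

Lemma uniq_supp_seq p : uniq (supp_seq p).
Proof.
apply: filter_uniq; apply: allpairs_uniq_dep => [|k _|]; try exact: iota_uniq.
by move=> [k l] [k' l'] _ _ /= [-> ->].
Qed.

Lemma mem_supp_seq p w : (w \in supp_seq p) = (coefXY p w.1 w.2 != 0).
Proof.
rewrite mem_filter andb_idr //; case: w => [[k|k] [l|l]] //=; rewrite ?eqxx //.
move=> c0; apply/allpairsPdep; exists k, l; split=> //; rewrite mem_iota /= add0n.
  by apply: contraNT c0; rewrite -leqNgt => /(nth_default 0) ->; rewrite coef0.
by apply: contraNT c0; rewrite -leqNgt => /(nth_default 0) ->.
Qed.

Lemma horner_supp_seq p z :
  p.[z.1, z.2] = \sum_(w <- supp_seq p) coefXY p w.1 w.2 * monomXY z w.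
Proof.
rewrite big_filter big_mkcond big_allpairs_dep /= (horner_coef p) horner_sum.
rewrite -[in RHS](subn0 (size p)) -/(index_iota _ _) big_mkord.
apply: eq_bigr => k _; rewrite -(subn0 (size p`_k)) -/(index_iota _ _) big_mkord.
rewrite hornerM horner_coef -rmorphXn hornerC mulr_suml; apply: eq_bigr => l _.
case: eqVneq => [->|_] /=; first by rewrite !mul0r.
by rewrite /monomXY mulrAC mulrA.
Qed.

Lemma horner2_continuous p : continuous (fun z : R * R => p.[z.1, z.2]).
Proof.
have -> : (fun z : R * R => p.[z.1, z.2]) =
    fun z => \sum_(k < size p) (p`_k).[z.2] * z.1 ^+ k.
  apply/funext => z; rewrite (horner_coef p) horner_sum; apply: eq_bigr => k _.
  by rewrite hornerM -rmorphXn hornerC.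
apply: continuous_big => [|k _ z]; first exact: add_continuous.
apply: cvgM.
  by apply: (@cvg_comp _ _ _ snd (horner (p`_k)) _ (nbhs z.2));
    [exact: cvg_snd|exact: continuous_horner].
by apply: (@cvg_comp _ _ _ fst (fun x : R => x ^+ k) _ (nbhs z.1));
    [exact: cvg_fst|exact: exprn_continuous].
Qed.

(** The restriction of p to the y-axis vanishes identically only if x divides
    p, and a nonzero polynomial has bounded roots. *)
Lemma axis_roots_bounded p : (~ exists q, p = 'X * q) ->
  exists B : R, forall y, p.[0, y] = 0 -> `|y| <= B.
Proof.
move=> ndvd; have [p0|/Cauchy_root_bound[B Bp]] := eqVneq p.[0%:P] 0.
  have /factor_theorem[q qE] : root p 0 by apply/eqP; rewrite -[0 in LHS]polyC0.
  by case: ndvd; exists q; rewrite qE subr0 mulrC.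
by exists B => y /eqP; exact: Bp.
Qed.

Lemma axis_roots_boundedY p : (~ exists q, p = 'Y * q) ->
  exists B : R, forall x, p.[x, 0] = 0 -> `|x| <= B.
Proof.
move=> ndvd; case: (@axis_roots_bounded (swapXY p)) => [[q qE]|B pB].
  by apply: ndvd; exists (swapXY q); rewrite -swapXY_X -rmorphM -qE /= swapXYK.
by exists B => x px0; apply: pB; rewrite horner2_swapXY.
Qed.

Lemma monomXYD z w w' : z.1 != 0 -> z.2 != 0 ->
  monomXY z (w + w') = monomXY z w * monomXY z w'.
Proof. by move=> x0 y0; rewrite /monomXY !expfzDr //= mulrACA. Qed.

Lemma monomXY_neq0 z w : z.1 != 0 -> z.2 != 0 -> monomXY z w != 0.
Proof. by move=> x0 y0; rewrite mulf_neq0 // expfz_neq0. Qed.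

End Poly.

(** * Growth along an ultrafilter *)

Lemma sqr_norm_gt0 (R : realType) (a b : R) :
  (a != 0) || (b != 0) -> 0 < a ^+ 2 + b ^+ 2.
Proof.
move=> ab0; rewrite lt_neqAle addr_ge0 ?sqr_ge0 // andbT eq_sym.
by rewrite paddr_eq0 ?sqr_ge0 // !sqrf_eq0 negb_and.
Qed.

Lemma total_preorder_max (I : eqType) (s : seq I) (r : I -> I -> Prop) :
  (forall i j, r i j \/ r j i) -> (forall j i k, r i j -> r j k -> r i k) ->
  s != [::] -> exists2 i0, i0 \in s & forall i, i \in s -> r i i0.
Proof.
move=> r_total r_trans; have r_refl i : r i i by case: (r_total i i).
elim: s => // i s IHs _; have [->|/IHs[i0 i0s max_i0]] := eqVneq s [::].
  by exists i => [|j]; rewrite !inE // => /eqP ->.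
have [le_i|le_i0] := r_total i i0.
  exists i0 => [|j]; first by rewrite inE i0s orbT.
  by rewrite inE => /predU1P[->|/max_i0].
exists i => [|j]; rewrite inE ?eqxx // => /predU1P[->|/max_i0] //.
by move=> le_j; exact: r_trans le_j le_i0.
Qed.

Section Growth.
Context {R : realType} {T : Type} {F : set_system T} {UF : UltraFilter F}.

(** The dichotomy that replaces the extraction of subsequences. *)
Lemma ultra_bounded_below_or_Ny (g : T -> R) :
  (exists K, \forall z \near F, K <= g z) \/ g z @[z --> F] --> -oo.
Proof.
have [|nbd] := pselect (exists K, \forall z \near F, K <= g z); first by left.
right; apply/cvgrNyPle => K.
have [FK|] := in_ultra_setVsetC [set z | K <= g z] UF.
  by case: nbd; exists K.
by apply: filterS => z /negP; rewrite -ltNge => /ltW.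
Qed.

Lemma ultra_le_total (f g : T -> R) :
  (\forall z \near F, f z <= g z) \/ (\forall z \near F, g z <= f z).
Proof.
have [|ngt] := in_ultra_setVsetC [set z | f z <= g z] UF; first by left.
by right; apply: filterS ngt => z /negP; rewrite -ltNge => /ltW.
Qed.

Lemma ultra_max (I : eqType) (s : seq I) (f : I -> T -> R) : s != [::] ->
  exists2 i0, i0 \in s & forall i, i \in s -> \forall z \near F, f i z <= f i0 z.
Proof.
apply: (@total_preorder_max _ _ (fun i j => \forall z \near F, f i z <= f j z)).
  by move=> i j; exact: ultra_le_total.
by move=> j i k le_ij le_jk; apply: filterS2 le_ij le_jk => z; exact: le_trans.
Qed.

(** With d h = c S + k B, only the term c S can carry the growth of h, since
    B is bounded; as S is nonnegative, this requires c > 0 and S divergent. *)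
Lemma forced_growth (h S B : T -> R) (c d k K : R) : 0 < d ->
  (\forall z \near F, d * h z = c * S z + k * B z) ->
  (\forall z \near F, 0 <= S z) -> (\forall z \near F, `|B z| <= K) ->
  h z @[z --> F] --> +oo -> 0 < c /\ S z @[z --> F] --> +oo.
Proof.
move=> d0 hE S0 BK /cvgryPge hoo.
have upper : \forall z \near F, d * h z <= c * S z + `|k| * K.
  near=> z; rewrite (near hE z) // lerD2l (le_trans (ler_norm _)) // normrM.
  by rewrite ler_wpM2l // (near BK z).
have c0 : 0 < c.
  rewrite ltNge; apply/negP => c0.
  have [z [zS zu zh]] : exists z, [/\ 0 <= S z, d * h z <= c * S z + `|k| * K
      & (`|k| * K + 1) / d <= h z].
    apply: (@filter_ex _ F); near=> z; split; near: z;
      [exact: S0|exact: upper|exact: hoo].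
  move: zh; rewrite ler_pdivrMr // mulrC => zh.
  have := mulr_le0_ge0 c0 zS; lra.
split=> //; apply/cvgryPge => A; near=> z.
rewrite -(ler_pM2l c0) -(lerD2r (`|k| * K)).
rewrite (le_trans _ (near upper z _)) // [d * _]mulrC -ler_pdivrMr //.
by near: z; exact: hoo.
Unshelve. all: by end_near. Qed.

Lemma driven_growth (h S B : T -> R) (c d k K : R) : 0 < d -> 0 < c ->
  (forall z, d * h z = c * S z + k * B z) ->
  (\forall z \near F, `|B z| <= K) -> S z @[z --> F] --> +oo ->
  h z @[z --> F] --> +oo.
Proof.
move=> d0 c0 hE BK /cvgryPge Soo; apply/cvgryPge => A; near=> z.
rewrite -(ler_pM2l d0) hE.
have kB : `|k * B z| <= `|k| * K by rewrite normrM ler_wpM2l // (near BK z).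
have : (d * A + `|k| * K) / c <= S z by near: z; exact: Soo.
rewrite ler_pdivrMr // => cS; have := ler_norm (- (k * B z)); rewrite normrN; lra.
Unshelve. all: by end_near. Qed.

(** The vector (u, v) is unbounded but its component along (p, q) is bounded, so
    its component s along the orthogonal vector (- q, p) diverges.  The sign e
    turns that vector so that the component diverges to +oo.  The coordinate of
    (u, v) tending to +oo is, up to a bounded term, s times the corresponding
    coordinate of the direction, which is therefore positive. *)
Lemma growth_direction (u v : T -> R) (p q K : R) :
  (p != 0) || (q != 0) ->
  (\forall z \near F, `|p * u z + q * v z| <= K) ->
  (u z @[z --> F] --> +oo \/ v z @[z --> F] --> +oo) ->
  exists e : R, let a := - (e * q) in let b := e * p in
    [/\ e ^+ 2 = 1, 0 < a \/ 0 < b & a * u z + b * v z @[z --> F] --> +oo].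
Proof.
move=> pq0 bnd infty; pose s z := - q * u z + p * v z.
have [e e1 es] : exists2 e, e ^+ 2 = 1 & \forall z \near F, 0 <= e * s z.
  have [s0|s0] := ultra_le_total (fun=> 0) s.
    by exists 1; rewrite ?expr1n //; apply: filterS s0 => z; rewrite mul1r.
  exists (-1); rewrite ?sqrrN ?expr1n //; apply: filterS s0 => z.
  by rewrite mulN1r oppr_ge0.
have d_gt0 : 0 < p ^+ 2 + q ^+ 2 by exact: sqr_norm_gt0.
exists e => a b.
have -> : (fun z => a * u z + b * v z) = fun z => e * s z.
  by apply/funext => z; rewrite /s /a /b; ring.
(* The coordinate that diverges is decomposed along (a, b) and (p, q). *)
case: infty => [uoo|voo].
  have [|a0 soo] := forced_growth (c := a) (k := p) d_gt0 _ es bnd uoo; last first.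
    by split=> //; left.
  apply: filterE => z; rewrite /a /s; transitivity
    (e ^+ 2 * q ^+ 2 * u z + p ^+ 2 * u z + (1 - e ^+ 2) * p * q * v z);
    by [rewrite e1; ring|ring].
have [|b0 soo] := forced_growth (c := b) (k := q) d_gt0 _ es bnd voo; last first.
  by split=> //; right.
apply: filterE => z; rewrite /b /s; transitivity
  (e ^+ 2 * p ^+ 2 * v z + q ^+ 2 * v z + (1 - e ^+ 2) * p * q * u z);
  by [rewrite e1; ring|ring].
Qed.

End Growth.

Lemma sum_vanishing (R : realType) (T : Type) (F : set_system T) (FF : Filter F)
    (I : eqType) (s : seq I) (P : pred I) (c : I -> R) (f g : I -> T -> R) :
  (forall i, i \in s -> P i -> \forall z \near F, `|f i z| = expR (g i z)) ->
  (forall i, i \in s -> P i -> g i z @[z --> F] --> -oo) ->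
  \sum_(i <- s | P i) c i * f i z @[z --> F] --> 0.
Proof.
move=> fE goo.
under eq_cvg do rewrite big_seq_cond.
suff : \sum_(i <- s | (i \in s) && P i) c i * f i z @[z --> F] -->
    \sum_(i <- s | (i \in s) && P i) (0 : R).
  by rewrite big1_eq.
apply: cvg_big => [|i /andP[si Pi]]; first exact: add_continuous.
rewrite -(mulr0 (c i)); apply: cvgMr; apply/norm_cvg0P.
have : expR (g i z) @[z --> F] --> 0.
  by apply: (cvg_comp _ _ (goo i si Pi)); exact/cvgNy_compNP/cvgr_expR.
by apply: cvg_trans; apply: near_eq_cvg; apply: filterS (fE i si Pi) => z ->.
Qed.

Section MonomGrowth.
Context {R : realType}.
Implicit Types (z : R * R) (w : int * int).

(** The logarithm of the size of the monomial, when neither coordinate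
    vanishes. *)
Definition weight z w : R := w.1%:~R * ln `|z.1| + w.2%:~R * ln `|z.2|.

Lemma norm_exprz_expR (x : R) (k : int) : x != 0 ->
  `|x ^ k| = expR (k%:~R * ln `|x|).
Proof.
move=> x0; have xE n : `|x ^+ n| = expR (n%:R * ln `|x|).
  by rewrite expRM_natl lnK ?posrE ?normr_gt0 // normrX.
case: k => n; first exact: xE.
by rewrite NegzE -exprnN normfV xE mulrNz mulNr expRN.
Qed.

Lemma norm_monomXY z w : z.1 != 0 -> z.2 != 0 ->
  `|monomXY z w| = expR (weight z w).
Proof. by move=> x0 y0; rewrite normrM !norm_exprz_expR // -expRD. Qed.

Lemma weightD z w w' : weight z (w + w') = weight z w + weight z w'.
Proof. by rewrite /weight !intrD; ring. Qed.

Lemma weight_mulrn z w (i : nat) : weight z (w *+ i) = i%:R * weight z w.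
Proof.
elim: i => [|i IHi]; first by rewrite /weight !mul0r addr0.
by rewrite mulrSr weightD IHi -natr1 mulrDl mul1r.
Qed.

End MonomGrowth.

(** * Faces of a convex hull in the plane *)

Section Faces.
Context {R : realType}.
Implicit Types (z : plane R) (S : set (plane R)).

Lemma segmentP (x y z : plane R) : segment x y z <->
  exists t : R, [/\ 0 <= t <= 1, z.1 = t * x.1 + (1 - t) * y.1
                  & z.2 = t * x.2 + (1 - t) * y.2].
Proof.
split=> [[t _ <-]|[t [/andP[t0 t1] z1 z2]]].
  by exists t%:num; split=> //; rewrite ge0 le1.
by exists (Itv01 t0 t1) => //; case: z z1 z2 => ? ? /= -> ->.
Qed.

Lemma convex_setP S : convex_set S <->
  forall x y, S x -> S y -> segment x y `<=` S.
Proof.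
split=> [cS x y Sx Sy _ [t _ <-]|cS x y t]; last first.
  by rewrite !inE => Sx Sy; apply: cS Sx Sy _ _; exists t.
by have := cS x y t; rewrite !inE; apply.
Qed.

Definition lin (a b : R) z : R := a * z.1 + b * z.2.

Lemma convex_hull_convex S : convex_set (convex_hull S).
Proof.
apply/convex_setP => x y Sx Sy z zxy A [cA SA].
by move/convex_setP: (cA); apply; [apply: Sx|apply: Sy|exact: zxy].
Qed.

(** Half-planes are convex, so a linear bound on S passes to its hull. *)
Lemma hull_halfplane (a b m : R) S : S `<=` [set z | lin a b z <= m] ->
  convex_hull S `<=` [set z | lin a b z <= m].
Proof.
apply: smallest_sub; apply/convex_setP => x y /= xm ym z /segmentP.
move=> [t [/andP[t0 t1] z1 z2]]; rewrite /= /lin z1 z2 in xm ym *.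
have t'0 : 0 <= 1 - t by rewrite subr_ge0.
have := ler_wpM2l t0 xm; have := ler_wpM2l t'0 ym; lra.
Qed.

Lemma argmax_hull (a b : R) S x :
  S x -> (forall z, S z -> lin a b z <= lin a b x) ->
  argmax a b (convex_hull S) =
    convex_hull S `&` [set z | lin a b z = lin a b x].
Proof.
move=> Sx max_x; have hull_x : convex_hull S x by exact: sub_gen_smallest.
have le_x := hull_halfplane max_x.
apply/seteqP; split=> z [hz].
  move=> max_z; split=> //=; apply/eqP; rewrite eq_le (le_x z hz).
  exact: max_z.
by move=> /= zx; split=> // w hw; have := le_x w hw; rewrite /= -zx.
Qed.

(** Along the line where the form (a, b) is maximal, the orthogonal form tau is
    a coordinate; the endpoints are the points of s on that line where tau is
    extremal. *)
Lemma face_segment (a b : R) (s : seq (plane R)) x y :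
  x \in s -> y \in s -> x != y -> lin a b x = lin a b y ->
  (forall z, z \in s -> lin a b z <= lin a b x) -> (a != 0) || (b != 0) ->
  exists u v : plane R, [/\ u \in s, v \in s, u != v
    & argmax a b (convex_hull [set` s]) = segment u v].
Proof.
move=> xs ys xy linxy max_x ab0.
have D0 : 0 < a ^+ 2 + b ^+ 2 by exact: sqr_norm_gt0.
pose m := lin a b x; pose tau := lin (- b) a.
have coordE z : z.1 = (a * lin a b z - b * tau z) / (a ^+ 2 + b ^+ 2) /\
                z.2 = (b * lin a b z + a * tau z) / (a ^+ 2 + b ^+ 2).
  by rewrite /tau /lin; split; field; exact: lt0r_neq0.
have lin_inj z z' : lin a b z = lin a b z' -> tau z = tau z' -> z = z'.
  move=> lz tz; have [z1 z2] := coordE z; have [z1' z2'] := coordE z'.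
  by rewrite [LHS]surjective_pairing z1 z2 lz tz -z1' -z2' -surjective_pairing.
pose f := [seq z <- s | lin a b z == m].
have xf : x \in f by rewrite mem_filter eqxx.
have yf : y \in f by rewrite mem_filter -linxy eqxx.
have f0 : f != [::] by apply: contraTneq xf => ->.
have [|j i k|v vf max_v] :=
  @total_preorder_max _ f (fun z z' => tau z <= tau z') _ _ f0.
- by move=> i j; apply/orP; exact: le_total.
- exact: le_trans.
have [|j i k|u uf min_u] :=
  @total_preorder_max _ f (fun z z' => tau z' <= tau z) _ _ f0.
- by move=> i j; apply/orP; exact: le_total.
- by move=> ij jk; exact: le_trans jk ij.
move: (uf) (vf); rewrite !mem_filter => /andP[/eqP um us] /andP[/eqP vm vs].
have tau_uv : tau u < tau v.
  rewrite lt_neqAle (le_trans (min_u x xf) (max_v x xf)) andbT.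
  apply: contra_neq xy => tuv; apply: lin_inj => //; apply/eqP.
  by rewrite eq_le (le_trans (max_v x xf)) ?(le_trans (max_v y yf)) //
     -tuv min_u.
exists u, v; split=> //; first by apply: contraTneq tau_uv => ->; rewrite ltxx.
rewrite (argmax_hull (x := x)) //; apply/seteqP; split; last first.
  move=> z zuv; split.
    move/convex_setP: (@convex_hull_convex [set` s]); apply; last exact: zuv;
      exact: sub_gen_smallest.
  move: zuv => /segmentP[t [_ z1 z2]] /=.
  transitivity (t * lin a b u + (1 - t) * lin a b v).
    by rewrite /lin z1 z2; ring.
  by rewrite um vm -/m; ring.
move=> z [hz /= zm].
(* S is the half-plane below the line, with the line itself cut down to the
   segment from u to v.  It is convex: a convex combination lies on the line
   only if every point of nonzero coefficient does. *)
pose S := [set z | lin a b z <= m /\ (lin a b z = m -> tau u <= tau z <= tau v)].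
have /(_ z hz)[_ /(_ zm)/andP[uz zv]] : convex_hull [set` s] `<=` S.
  apply: smallest_sub => [|w /= ws]; last first.
    split=> [|wm]; first exact: max_x.
    by have wf : w \in f; [rewrite mem_filter wm eqxx|rewrite min_u // max_v].
  apply/convex_setP => z1 z2 [le1 tau1] [le2 tau2] w /segmentP[t [/andP[t0 t1] w1 w2]].
  have linE a' b' : lin a' b' w = t * lin a' b' z1 + (1 - t) * lin a' b' z2.
    by rewrite /lin w1 w2; ring.
  have t'0 : 0 <= 1 - t by rewrite subr_ge0.
  have := ler_wpM2l t0 le1; have := ler_wpM2l t'0 le2.
  move=> l2 l1; split=> [|]; first by rewrite linE; lra.
  move=> wm; rewrite /tau linE -!/(tau _).
  have e1 : t * (m - lin a b z1) = 0 by move: wm; rewrite linE; lra.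
  have e2 : (1 - t) * (m - lin a b z2) = 0 by move: wm; rewrite linE; lra.
  have b1 : t * tau u <= t * tau z1 <= t * tau v.
    move/eqP: e1; rewrite mulf_eq0 => /orP[/eqP->|]; first by rewrite !mul0r lexx.
    by rewrite subr_eq0 => /eqP/esym/tau1 /andP[? ?]; rewrite !ler_wpM2l.
  have b2 : (1 - t) * tau u <= (1 - t) * tau z2 <= (1 - t) * tau v.
    move/eqP: e2; rewrite mulf_eq0 => /orP[/eqP->|]; first by rewrite !mul0r lexx.
    by rewrite subr_eq0 => /eqP/esym/tau2 /andP[? ?]; rewrite !ler_wpM2l.
  lra.
have tau0 : 0 < tau v - tau u by rewrite subr_gt0.
pose t := (tau v - tau z) / (tau v - tau u).
have tE : t * tau u + (1 - t) * tau v = tau z.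
  by rewrite /t; field; exact: lt0r_neq0.
apply/segmentP; exists t; split.
- by rewrite divr_ge0 ?ler_pdivrMr ?mul1r ?subr_ge0 ?(ltW tau_uv) //= lerD2l lerN2.
- have [-> _] := coordE z; have [-> _] := coordE u; have [-> _] := coordE v.
  by rewrite zm um vm -tE -/m; field; exact: lt0r_neq0.
- have [_ ->] := coordE z; have [_ ->] := coordE u; have [_ ->] := coordE v.
  by rewrite zm um vm -tE -/m; field; exact: lt0r_neq0.
Qed.

End Faces.

(** * Lattice points of an edge and the edge polynomial *)

Definition edge_len (u v : int * int) : int := gcdz (v.1 - u.1) (v.2 - u.2).

Definition edge_step (u v : int * int) : int * int :=
  (((v.1 - u.1) %/ edge_len u v)%Z, ((v.2 - u.2) %/ edge_len u v)%Z).

Section Edges.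
Context {R : realType}.
Implicit Types (z : R * R) (u v w : int * int).

Lemma edge_len_gt0 u v : u != v -> 0 < edge_len u v.
Proof.
move=> uv; rewrite lt_neqAle eq_sym gcdz_eq0 !subr_eq0 andbT.
apply: contra uv => /andP[/eqP e1 /eqP e2].
by rewrite [u]surjective_pairing -e1 -e2 -surjective_pairing.
Qed.

Lemma edge_stepE u v : v.1 - u.1 = (edge_step u v).1 * edge_len u v /\
  v.2 - u.2 = (edge_step u v).2 * edge_len u v.
Proof. by rewrite /= !divzK ?dvdz_gcdl ?dvdz_gcdr. Qed.

Lemma edge_step_neq0 u v : u != v -> edge_step u v != 0.
Proof.
move=> uv; apply: contraNneq uv => step0.
have [] := edge_stepE u v; rewrite step0 !mul0r => /eqP + /eqP.
rewrite !subr_eq0 => /eqP e1 /eqP e2.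
by rewrite [u]surjective_pairing -e1 -e2 -surjective_pairing.
Qed.

Lemma mulrn_pairE (w : int * int) (i : nat) :
  w *+ i = (i%:Z * w.1, i%:Z * w.2).
Proof.
elim: i => [|i IHi]; first by rewrite mulr0n !mul0r.
rewrite mulrSr IHi; transitivity (i%:Z * w.1 + w.1, i%:Z * w.2 + w.2) => //.
by rewrite intS !mulrDl !mul1r [w.1 + _]addrC [w.2 + _]addrC.
Qed.

(** Let d = x (v.1 - u.1) + y (v.2 - u.2) be the Bezout relation for the length
    d.  As w - u is a multiple of v - u by a factor in [0, 1], a lattice point w
    of the segment is reached from u after x (w.1 - u.1) + y (w.2 - u.2) steps,
    an integer between 0 and d. *)
Lemma lattice_segmentP u v w : u != v ->
  segment (lattice_point R u) (lattice_point R v) (lattice_point R w) <->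
  exists2 i : nat, (i < `|edge_len u v|%N.+1)%N & w = u + edge_step u v *+ i.
Proof.
move=> uv; have d0 := edge_len_gt0 uv; have [Dx Dy] := edge_stepE u v.
set d := edge_len u v in d0 Dx Dy *; set s := edge_step u v in Dx Dy *.
have dE : d = `|d|%N :> int by rewrite gez0_abs // ltW.
have dR0 : 0 < d%:~R :> R by rewrite ltr0z.
have [DxR DyR] : v.1%:~R - u.1%:~R = s.1%:~R * d%:~R :> R /\
                 v.2%:~R - u.2%:~R = s.2%:~R * d%:~R :> R.
  by rewrite -!intrB Dx Dy !intrM.
split=> [/segmentP[t [/andP[t0 t1] /= w1 w2]]|[i + ->]]; last first.
  rewrite ltnS -lez_nat -dE -(ler_int R) => id.
  have iR : i%:Z%:~R = i%:R :> R by [].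
  rewrite iR in id.
  apply/segmentP; exists (1 - i%:R / d%:~R); split.
  - rewrite subr_ge0 ler_pdivrMr // mul1r id /= gerBl.
    by rewrite divr_ge0 ?ler0n // ltW.
  - rewrite mulrn_pairE /= intrD intrM iR.
    have -> : v.1%:~R = u.1%:~R + s.1%:~R * d%:~R :> R by rewrite -DxR; ring.
    by field; exact: lt0r_neq0.
  - rewrite mulrn_pairE /= intrD intrM iR.
    have -> : v.2%:~R = u.2%:~R + s.2%:~R * d%:~R :> R by rewrite -DyR; ring.
    by field; exact: lt0r_neq0.
have [x [y xyd]] := Bezoutz (v.1 - u.1) (v.2 - u.2); rewrite -/(edge_len u v) -/d in xyd.
pose j := x * (w.1 - u.1) + y * (w.2 - u.2).
have w1' : w.1%:~R - u.1%:~R = (1 - t) * (v.1 - u.1)%:~R :> R.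
  by rewrite w1 intrB; ring.
have w2' : w.2%:~R - u.2%:~R = (1 - t) * (v.2 - u.2)%:~R :> R.
  by rewrite w2 intrB; ring.
have jR : j%:~R = (1 - t) * d%:~R :> R.
  by rewrite /j -xyd !intrD !intrM !intrB w1' w2' !intrB; ring.
have wE : w.1 = u.1 + j * s.1 /\ w.2 = u.2 + j * s.2.
  split; apply: (mulrIz (oner_neq0 R)); rewrite intrD intrM jR.
    have := w1'; rewrite Dx intrM => /(canRL (subrK _)) ->; ring.
  have := w2'; rewrite Dy intrM => /(canRL (subrK _)) ->; ring.
have j0 : 0 <= j by rewrite -(ler0z R) jR mulr_ge0 ?subr_ge0 // ltW.
have jd : j <= d by rewrite -(ler_int R) jR ler_piMl ?gerBl // ltW.
exists `|j|%N; first by rewrite ltnS -lez_nat -dE gez0_abs.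
rewrite mulrn_pairE gez0_abs //.
by case: wE => e1 e2; rewrite [w]surjective_pairing e1 e2.
Qed.

Lemma monomXY_mulrn z w (i : nat) : z.1 != 0 -> z.2 != 0 ->
  monomXY z (w *+ i) = monomXY z w ^+ i.
Proof.
move=> x0 y0; elim: i => [|i IHi]; last by rewrite mulrSr exprSr monomXYD // IHi.
by rewrite /monomXY /= !expr0z mulr1.
Qed.

(** The terms of the edge polynomial are indexed by all the lattice points of
    the segment; those outside the support have coefficient zero, so both sides
    are the same sum after dividing by the monomial of u. *)
Lemma edge_poly_sum p z u v : z.1 != 0 -> z.2 != 0 -> u != v ->
  \sum_(w <- supp_seq p | `[< segment (lattice_point R u) (lattice_point R v)
                                (lattice_point R w) >])
    coefXY p w.1 w.2 * monomXY z w =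
  monomXY z u * (edge_poly p u v).[monomXY z (edge_step u v)].
Proof.
move=> x0 y0 uv; set s := edge_step u v; set d := `|edge_len u v|%N.
pose term w := coefXY p w.1 w.2 * monomXY z w.
have s0 : s != 0 by exact: edge_step_neq0.
pose pts := [seq u + s *+ i | i <- iota 0 d.+1].
have uniq_pts : uniq pts.
  rewrite map_inj_uniq ?iota_uniq // => i j /addrI; rewrite !mulrn_pairE => -[e1 e2].
  apply/eqP; move: s0; apply: contraNT => ij.
  have {}ij : i%:Z - j%:Z != 0 by rewrite subr_eq0.
  rewrite [s]surjective_pairing; apply/eqP; congr pair; apply: (mulfI ij);
    by rewrite mulr0 mulrBl ?e1 ?e2 subrr.
transitivity (\sum_(w <- pts) term w).
  rewrite -big_filter [RHS](bigID (fun w => coefXY p w.1 w.2 == 0)) /= [X in _ = X + _]big1.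
    rewrite add0r -[RHS]big_filter; apply: perm_big; apply: uniq_perm.
    - by rewrite filter_uniq ?uniq_supp_seq.
    - exact: filter_uniq.
    move=> w; rewrite mem_filter mem_supp_seq mem_filter andbC; congr andb.
    apply/asboolP/mapP => [/(lattice_segmentP _ uv)[i id ->]|[i]].
      by exists i; rewrite ?mem_iota.
    by rewrite mem_iota => /andP[_ id] ->; apply/lattice_segmentP => //; exists i.
  by move=> w /eqP c0; rewrite /term c0 mul0r.
rewrite big_map -[iota 0 _]/(index_iota 0 d.+1) big_mkord horner_poly mulr_sumr.
apply: eq_bigr => i _; rewrite /term monomXYD // monomXY_mulrn // mulrn_pairE /=.
by rewrite mulrCA.
Qed.

End Edges.

(** * Zeros escaping to infinity *)

Section Main.
Context {R : realType}.
Implicit Types (p : {poly {poly R}}).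

Lemma polygonE p :
  newton_polygon p = convex_hull [set` [seq lattice_point R w | w <- supp_seq p]].
Proof.
congr convex_hull; apply/seteqP; split=> [_ [w cw <-]|z /mapP[w + ->]].
  by apply: map_f; rewrite mem_supp_seq.
by rewrite mem_supp_seq => cw; exists w.
Qed.

Lemma lattice_point_inj : injective (lattice_point R).
Proof. by move=> [a b] [a' b'] [] /intr_inj -> /intr_inj ->. Qed.

Section Escape.
Context {F : set_system (R * R)} {UF : UltraFilter F}.

(** Since p vanishes, the part of p supported on P is the opposite of the rest,
    which is negligible with respect to the monomial of u. *)
Lemma dominant_part_vanishes p (P : pred (int * int)) (u : int * int) :
  (\forall z \near F, z.1 != 0 /\ z.2 != 0) ->
  (\forall z \near F, p.[z.1, z.2] = 0) ->
  (forall w, w \in supp_seq p -> ~~ P w ->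
    weight z w - weight z u @[z --> F] --> -oo) ->
  (\sum_(w <- supp_seq p | P w) coefXY p w.1 w.2 * monomXY z w) / monomXY z u
    @[z --> F] --> 0.
Proof.
move=> xy0 p0 small.
have : \sum_(w <- supp_seq p | ~~ P w)
    coefXY p w.1 w.2 * (monomXY z w / monomXY z u) @[z --> F] --> 0.
  apply: (@sum_vanishing _ _ _ _ _ _ _ _ _
    (fun w z => weight z w - weight z u)) => // w _ _.
  apply: filterS xy0 => z [x0 y0].
  by rewrite normrM normfV !norm_monomXY // expRB.
move/cvgN; rewrite oppr0; apply: cvg_trans; apply: near_eq_cvg; apply: filterS2 xy0 p0.
move=> z [x0 y0]; rewrite horner_supp_seq (bigID P) /= => /eqP.
rewrite addr_eq0 => /eqP /= Pz.
transitivity (- \sum_(w <- supp_seq p | ~~ P w)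
  coefXY p w.1 w.2 * (monomXY z w / monomXY z u)) => //.
rewrite Pz mulNr mulr_suml; congr (- _).
by apply: eq_bigr => w _; rewrite mulrA.
Qed.

(** The minimum of |e| on the compact interval [- M, M] is attained, hence
    nonzero. *)
Lemma poly_bounded_away (e : {poly R}) (M : R) : 0 <= M ->
  (forall t, ~~ root e t) ->
  exists2 c, 0 < c & forall t, `|t| <= M -> c <= `|e.[t]|.
Proof.
move=> M0 rootless.
have [||t0 _ min_t0] := @EVT_min R (fun t => `|e.[t]|) (- M) M.
- lra.
- apply: continuous_subspaceT => t; apply: cvg_norm; exact: continuous_horner.
exists `|e.[t0]|; first by rewrite normr_gt0 -/(root e t0).
by move=> t tM; apply: min_t0; rewrite in_itv /= -ler_norml.
Qed.

(** A point of F on one axis would be a root of the restriction of p to that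
    axis, and such roots are bounded; but the other coordinate diverges. *)
Lemma near_torus p :
  (~ exists q, p = 'X * q) -> (~ exists q, p = 'Y * q) ->
  (\forall z \near F, p.[z.1, z.2] = 0) ->
  (`|z.1| @[z --> F] --> +oo \/ `|z.2| @[z --> F] --> +oo) ->
  \forall z \near F, z.1 != 0 /\ z.2 != 0.
Proof.
move=> /axis_roots_bounded[B1 pB1] /axis_roots_boundedY[B2 pB2] p0 infty.
have nearB (f : R * R -> R) B : `|f z| @[z --> F] --> +oo ->
    \forall z \near F, B < `|f z|.
  by move/cvgryPgt; apply.
case: infty => infty.
  apply: filterS3 (nearB fst B2 infty) (nearB fst 0 infty) p0 => -[x y] /= Bx x0 pxy.
  split; first by rewrite -normr_gt0.
  by apply: contraTneq Bx => y0; rewrite -leNgt pB2 // -[RHS]pxy y0.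
apply: filterS3 (nearB snd B1 infty) (nearB snd 0 infty) p0 => -[x y] /= By y0 pxy.
split; last by rewrite -normr_gt0.
by apply: contraTneq By => x0; rewrite -leNgt pB1 // -[RHS]pxy x0.
Qed.

Lemma ln_growth (f : R * R -> R) : `|f z| @[z --> F] --> +oo ->
  ln `|f z| @[z --> F] --> +oo.
Proof.
move=> /cvgryPge foo; apply/cvgryPge => A; apply: filterS (foo (expR A)) => z Az.
by rewrite -[A]expRK ler_ln ?posrE ?expR_gt0 // (lt_le_trans (expR_gt0 A)).
Qed.

(** The heart of the argument: an ultrafilter of zeros escaping to infinity
    singles out an outer edge E that carries all the monomials of maximal order
    of growth.  Its normal is the direction in which (ln|x|, ln|y|) escapes. *)
Lemma escape_edge p :
  (\forall z \near F, z.1 != 0 /\ z.2 != 0) ->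
  (\forall z \near F, p.[z.1, z.2] = 0) ->
  (`|z.1| @[z --> F] --> +oo \/ `|z.2| @[z --> F] --> +oo) ->
  supp_seq p != [::] ->
  exists E w0 w1, [/\ is_outer_edge (newton_polygon p) E,
    w0 != w1, E (lattice_point R w0) /\ E (lattice_point R w1),
    (exists K, \forall z \near F, `|weight z w1 - weight z w0| <= K) &
    forall w, w \in supp_seq p -> ~ E (lattice_point R w) ->
      weight z w - weight z w0 @[z --> F] --> -oo].
Proof.
move=> xy0 p0 infty supp0.
have [w0 w0s max_w0] := ultra_max (fun w z => weight z w) supp0.
(* If w0 dominated all the other monomials, its coefficient would tend to 0. *)
have [w1 w1s [w10 [K wK]]] : exists2 w1, w1 \in supp_seq p & w1 != w0 /\
    exists K, \forall z \near F, `|weight z w1 - weight z w0| <= K.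
  have [//|alone] := pselect (exists2 w1, w1 \in supp_seq p & w1 != w0 /\
    exists K, \forall z \near F, `|weight z w1 - weight z w0| <= K).
  have c0 : coefXY p w0.1 w0.2 != 0 by rewrite -mem_supp_seq.
  have /cvgr0_norm_lt : (\sum_(w <- supp_seq p | w == w0)
      coefXY p w.1 w.2 * monomXY z w) / monomXY z w0 @[z --> F] --> 0.
    apply: dominant_part_vanishes => // w ws ww0.
    have [[K wK]|//] :=
      ultra_bounded_below_or_Ny (fun z => weight z w - weight z w0).
    case: alone; exists w => //; split=> //; exists (- K).
    apply: filterS2 wK (max_w0 w ws) => z wK ww; rewrite ler0_norm ?lerN2 //.
    by rewrite subr_le0.
  move=> /(_ `|coefXY p w0.1 w0.2|); rewrite normr_gt0 => /(_ c0) lt_c.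
  have [z [[x0 y0]]] := @filter_ex _ F _ _ (filterI xy0 lt_c).
  rewrite -big_filter filter_pred1_uniq ?uniq_supp_seq // big_seq1.
  by rewrite mulfK ?monomXY_neq0 // ltxx.
pose dx : R := (w1.1 - w0.1)%:~R; pose dy : R := (w1.2 - w0.2)%:~R.
have dxy0 : (dx != 0) || (dy != 0).
  rewrite !intr_eq0 !subr_eq0 -negb_and; apply: contra w10 => /andP[/eqP e1 /eqP e2].
  by rewrite [w1]surjective_pairing e1 e2 -surjective_pairing.
pose U (z : R * R) := dx * ln `|z.1| + dy * ln `|z.2|.
have UE z : U z = weight z w1 - weight z w0.
  by rewrite /U /dx /dy /weight !intrB; ring.
have UK : \forall z \near F, `|U z| <= K by apply: filterS wK => z; rewrite UE.
have [|e [e1 outer Soo]] := growth_direction dxy0 UK.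
  by case: infty => /ln_growth; [left|right].
set a := - (e * dy) in outer Soo; set b := e * dx in outer Soo.
have ab0 : (a != 0) || (b != 0) by case: outer => /lt0r_neq0 ->; rewrite ?orbT.
have d0 : 0 < dx ^+ 2 + dy ^+ 2 by exact: sqr_norm_gt0.
pose slope w := lin a b (lattice_point R w) - lin a b (lattice_point R w0).
(* The difference w - w0 is decomposed along the orthogonal directions
   w1 - w0 and (a, b), which have the same length because e ^+ 2 = 1: the first
   component contributes a bounded amount to the weight, so the sign of the
   second decides whether the weight of w falls behind or overtakes w0. *)
have weightE w z : (dx ^+ 2 + dy ^+ 2) * (weight z w - weight z w0) =
    slope w * (a * ln `|z.1| + b * ln `|z.2|) +
    (dx * (w.1 - w0.1)%:~R + dy * (w.2 - w0.2)%:~R) * U z.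
  have -> : slope w * (a * ln `|z.1| + b * ln `|z.2|) =
      e ^+ 2 * ((dx * (w.2 - w0.2)%:~R - dy * (w.1 - w0.1)%:~R) *
                (dx * ln `|z.2| - dy * ln `|z.1|)).
    by rewrite /slope /lin /a /b /= !intrB; ring.
  by rewrite e1 /U /weight !intrB; ring.
have max_slope w : w \in supp_seq p -> slope w <= 0.
  move=> ws; rewrite leNgt; apply/negP => slope0.
  have /cvgryPgt above := @driven_growth _ _ _ UF
    (fun z => weight z w - weight z w0) _ U _ _ _ K d0 slope0 (weightE w) UK Soo.
  have [z []] := @filter_ex _ F _ _ (filterI (max_w0 w ws) (above 0)).
  by rewrite subr_gt0 => /le_lt_trans/[apply]; rewrite ltxx.
have fall w : slope w < 0 -> weight z w - weight z w0 @[z --> F] --> -oo.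
  move=> slope0; apply/cvgNry; have /= := @driven_growth _ _ _ UF
    (fun z => - (weight z w - weight z w0)) _ U (- slope w) _
    (- (dx * (w.1 - w0.1)%:~R + dy * (w.2 - w0.2)%:~R)) K d0 _ _ UK Soo.
  apply; first by rewrite oppr_gt0.
  by move=> z; rewrite mulrN weightE; ring.
have slope1 : slope w1 = 0.
  by rewrite /slope /lin /a /b /dx /dy /= !intrB; ring.
pose s := [seq lattice_point R w | w <- supp_seq p].
have lin_max z : z \in s -> lin a b z <= lin a b (lattice_point R w0).
  by move=> /mapP[w ws ->]; rewrite -subr_le0; exact: max_slope.
have lw01 : lattice_point R w0 != lattice_point R w1.
  by apply: contra_neq w10 => /lattice_point_inj.
have [x [y [_ _ xy EE]]] := @face_segment R a b s (lattice_point R w0)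
  (lattice_point R w1) (map_f _ w0s) (map_f _ w1s)
  lw01 (esym (subr0_eq slope1)) lin_max ab0.
have inE w : w \in supp_seq p -> slope w = 0 ->
    argmax a b (newton_polygon p) (lattice_point R w).
  move=> ws /subr0_eq sw; rewrite polygonE.
  rewrite (@argmax_hull _ _ _ [set` s] _ (map_f _ w0s)) //.
  by split=> //; apply: sub_gen_smallest; exact: map_f.
exists (argmax a b (newton_polygon p)), w0, w1; split.
- split; last by exists a, b; split.
  split; first by exists a, b.
  by exists x, y; split=> //; rewrite polygonE.
- by rewrite eq_sym.
- by split; apply: inE => //; rewrite /slope subrr.
- by exists K.
move=> w ws nE; apply: fall; rewrite lt_neqAle max_slope // andbT.
by apply/eqP => sw; apply: nE; exact: inE.
Qed.

(** On the edge E found above, dividing p by the monomial of the initial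
    endpoint leaves e_E(t) up to negligible terms.  The logarithm of |t| is the
    weight of the edge step, which is bounded because w1 - w0 is a nonzero
    integral multiple of that step. *)
Lemma rootless_edges_forbid_escape p
    (o : set (plane R) -> (int * int) * (int * int)) :
  is_orientation p o ->
  (~ exists q, p = 'X * q) -> (~ exists q, p = 'Y * q) ->
  (forall E, is_outer_edge (newton_polygon p) E ->
     forall t : R, ~~ root (edge_poly p (o E).1 (o E).2) t) ->
  (\forall z \near F, p.[z.1, z.2] = 0) ->
  ~ (`|z.1| @[z --> F] --> +oo \/ `|z.2| @[z --> F] --> +oo).
Proof.
move=> ho hx hy hE p0 infty; have xy0 := near_torus hx hy p0 infty.
have supp0 : supp_seq p != [::].
  have [B pB] := axis_roots_bounded hx; apply/eqP => supp0.
  have := pB (`|B| + 1); have := horner_supp_seq p (0, `|B| + 1).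
  rewrite supp0 big_nil => -> /(_ erefl).
  by rewrite ger0_norm ?addr_ge0 // leNgt ltr_pwDr // ler_norm.
have [E [w0 [w1 [outerE w01 [Ew0 Ew1] [K wK] small]]]] :=
  escape_edge xy0 p0 infty supp0.
have rootless := hE E outerE; have segE := ho E outerE.1.
set u := (o E).1 in rootless segE; set v := (o E).2 in rootless segE.
have uv : u != v.
  apply: contra_neq w01 => uv; apply: lattice_point_inj.
  suff onE w : E (lattice_point R w) -> lattice_point R w = lattice_point R v.
    by rewrite (onE _ Ew0) (onE _ Ew1).
  rewrite segE uv => /segmentP[t [_ e1 e2]].
  rewrite [LHS]surjective_pairing e1 e2 -!mulrDl addrC subrK !mul1r.
  by rewrite -surjective_pairing.
have [i _ w0E] : exists2 i, (i < `|edge_len u v|%N.+1)%N & w0 = u + edge_step u v *+ i.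
  by apply/(@lattice_segmentP R _ _ _ uv); rewrite -segE.
have [j _ w1E] : exists2 j, (j < `|edge_len u v|%N.+1)%N & w1 = u + edge_step u v *+ j.
  by apply/(@lattice_segmentP R _ _ _ uv); rewrite -segE.
(* The steps from u to w0 and w1 differ by the nonzero integer j - i, so the
   bound on the weight of w1 - w0 also bounds that of a single step. *)
have stepK : \forall z \near F, `|weight z (edge_step u v)| <= K.
  apply: filterS wK => z; rewrite w0E w1E !weightD !weight_mulrn.
  have -> : forall a b c d : R, a + b * d - (a + c * d) = (b - c) * d by move=> *; ring.
  rewrite normrM; apply: le_trans; rewrite ler_peMl //.
  have -> : j%:R - i%:R = (j%:Z - i%:Z)%:~R :> R by rewrite intrB.
  rewrite -intr_norm ler1z -gtz0_ge1 normr_gt0.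
  rewrite subr_eq0; apply: contra_neq w01 => -[ji].
  by rewrite w0E w1E ji.
have [c c0 away] := poly_bounded_away (ltW (expR_gt0 K)) rootless.
have /cvgr0_norm_lt/(_ c c0) lt_c : (\sum_(w <- supp_seq p |
      `[< segment (lattice_point R u) (lattice_point R v) (lattice_point R w) >])
    coefXY p w.1 w.2 * monomXY z w) / monomXY z u @[z --> F] --> 0.
  apply: dominant_part_vanishes => // w ws /asboolPn nE.
  apply/cvgrNyPle => A; rewrite -segE in nE.
  have /cvgrNyPle /(_ (A - i%:R * K)) := small w ws nE.
  apply: filterS2 stepK => z zK; rewrite w0E weightD weight_mulrn => le_A.
  have := ler_wpM2l (ler0n R i) (le_trans (ler_norm _) zK); lra.
have [z [[[x0 y0] zK]]] := @filter_ex _ F _ _ (filterI (filterI xy0 stepK) lt_c).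
rewrite edge_poly_sum // mulrAC divff ?monomXY_neq0 // mul1r ltNge away //.
by rewrite norm_monomXY // ler_expR (le_trans (ler_norm _)).
Qed.

End Escape.
End Main.

Theorem theorem1 (R : realType) (p : {poly {poly R}})
    (o : set (plane R) -> (int * int) * (int * int))
    (ho : is_orientation p o)
    (hx : ~ exists q : {poly {poly R}}, p = 'X * q)
    (hy : ~ exists q : {poly {poly R}}, p = 'Y * q)
    (hE : forall E : set (plane R), is_outer_edge (newton_polygon p) E ->
            forall t : R, ~~ root (edge_poly p (o E).1 (o E).2) t) :
  compact [set z : R * R | p.[z.1, z.2] = 0].
Proof.
set C := [set z : R * R | p.[z.1, z.2] = 0].
have closedC : closed C.
  apply: (@preimage_closed _ _ (fun z : R * R => p.[z.1, z.2]) [set 0]).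
    by move=> z _; exact: horner2_continuous.
  exact: closed_eq.
rewrite compact_ultra => F UF FC.
have noesc := rootless_edges_forbid_escape ho hx hy hE FC.
have bounded (f : R * R -> R) : ~ `|f z| @[z --> F] --> +oo ->
    exists K, \forall z \near F, `|f z| <= K.
  move=> nfoo; have [[K fK]|] := ultra_bounded_below_or_Ny (fun z => - `|f z|).
    by exists (- K); apply: filterS fK => z; rewrite lerNr.
  by move/cvgNry; rewrite opprK.
have [|K1 FK1] := bounded fst; first by move=> ?; apply: noesc; left.
have [|K2 FK2] := bounded snd; first by move=> ?; apply: noesc; right.
have boxC : compact ((`[- K1, K1] `*` `[- K2, K2]) `&` C).
  apply: compact_closedI => //; apply: compact_setX; exact: segment_compact.
rewrite compact_ultra in boxC; have [|z [[_ Cz] Fz]] := boxC F UF.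
  apply: filterS3 FK1 FK2 FC => z z1 z2 Cz; split=> //.
  by split; rewrite /= in_itv /= -ler_norml.
by exists z.
Qed.
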